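(* Let $(\mathfrak{g},[-,-],\omega)$ be a finite-dimensional nontrivial $\omega$-Lie algebra over $\mathbb{C}$. Then the set $\mathrm{Der}_{\omega}(\mathfrak{g})$ of all $\omega$-derivations of $\mathfrak{g}$ is a Lie subalgebra of the derivation algebra $\mathrm{Der}(\mathfrak{g})$.
   Context: An $\omega$-Lie algebra over $\mathbb{C}$ is a triple $(\mathfrak{g},[-,-],\omega)$ where $\mathfrak{g}$ is a finite-dimensional complex vector space, $[-,-]:\mathfrak{g}\times\mathfrak{g}\to\mathfrak{g}$ is a skew-symmetric bilinear bracket and $\omega:\mathfrak{g}\times\mathfrak{g}\to\mathbb{C}$ is a bilinear form (necessarily skew-symmetric in the nontrivial case) such that $$[[x,y],z]+[[y,z],x]+[[z,x],y]=\omega(x,y)z+\omega(y,z)x+\omega(z,x)y$$ for all $x,y,z\in\mathfrak{g}$. It is called nontrivial if $(\mathfrak{g},[-,-])$ is not a Lie algebra. A derivation of $\mathfrak{g}$ is a linear map $d:\mathfrak{g}\to\mathfrak{g}$ with $d([x,y])=[d(x),y]+[x,d(y)]$ for all $x,y\in\mathfrak{g}$. The set $\mathrm{Der}(\mathfrak{g})$ of all derivations is a Lie subalgebra of $\mathfrak{gl}(\mathfrak{g})$ (with commutator bracket $[d,e]=de-ed$). A derivation $d$ is an $\omega$-derivation if $\omega(d(x),y)+\omega(x,d(y))=0$ for all $x,y\in\mathfrak{g}$. *)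

(* Defs.v *)
From HB Require Import structures.
From mathcomp Require Import all_boot all_order all_algebra.
From mathcomp Require Import sesquilinear.
From mathcomp Require Import boolp classical_sets reals.
From mathcomp Require Export complex.

Set Implicit Arguments.
Unset Strict Implicit.
Unset Printing Implicit Defensive.

Import GRing.Theory.
Local Open Scope ring_scope.
Local Open Scope classical_set_scope.

Definition cyclic_bracket (K : fieldType) (V : lmodType K)
    (br : V -> V -> V) (x y z : V) : V :=
  br (br x y) z + br (br y z) x + br (br z x) y.

Definition is_lie_bracket (K : fieldType) (V : lmodType K)
    (br : {bilinear V -> V -> V}) : Prop :=
  (forall x, br x x = 0) /\ (forall x y z, cyclic_bracket br x y z = 0).

(* Skew-symmetry of the form is not required: it follows from the identity
   when the bracket is not a Lie bracket. *)
Record omega_lie (R : realType) (g : vectType R[i]) := OmegaLie {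
  bracket : {bilinear g -> g -> g};
  omega : {biscalar g};
  bracket_skew : forall x y, bracket x y = - bracket y x;
  omega_jacobi : forall x y z,
    cyclic_bracket bracket x y z =
      omega x y *: z + omega y z *: x + omega z x *: y }.

Definition nontrivial (R : realType) (g : vectType R[i]) (A : omega_lie g) :
    Prop :=
  ~ is_lie_bracket (bracket A).

Definition Der (R : realType) (g : vectType R[i]) (A : omega_lie g) :
    set 'End(g) :=
  [set d | forall x y,
     d (bracket A x y) = bracket A (d x) y + bracket A x (d y)].

Definition Der_omega (R : realType) (g : vectType R[i]) (A : omega_lie g) :
    set 'End(g) :=
  [set d | Der A d /\
     forall x y, omega A (d x) y + omega A x (d y) = 0].

Definition gl_bracket (K : fieldType) (V : vectType K) (d e : 'End(V)) :
    'End(V) :=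
  (d \o e)%VF - (e \o d)%VF.

Definition lie_closed (K : fieldType) (W : lmodType K) (br : W -> W -> W)
    (S : set W) : Prop :=
  submod_closed (mem S) /\ {in S &, forall u v, br u v \in S}.

(* S is a Lie subalgebra of the Lie algebra formed by L under br. *)
Definition lie_subalgebra (K : fieldType) (W : lmodType K)
    (br : W -> W -> W) (S L : set W) : Prop :=
  S `<=` L /\ lie_closed br S.

Lemma gl_bracketE (K : fieldType) (V : vectType K) (d e : 'End(V)) x :
  gl_bracket d e x = d (e x) - e (d x).
Proof. by rewrite /gl_bracket add_lfunE opp_lfunE !comp_lfunE. Qed.

Lemma gl_bracketxx (K : fieldType) (V : vectType K) (d : 'End(V)) :
  gl_bracket d d = 0.
Proof. exact: subrr. Qed.

Lemma gl_bracket_jacobi (K : fieldType) (V : vectType K) (a b c : 'End(V)) :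
  cyclic_bracket (@gl_bracket K V) a b c = 0.
Proof.
rewrite /cyclic_bracket /gl_bracket; apply/lfunP => x.
rewrite !(add_lfunE, opp_lfunE, comp_lfunE) zero_lfunE !linearB /=.
rewrite !opprK !addrA.
rewrite [LHS](ACl ((1*7)*(2*12)*((3*9)*(4*6))*((5*11)*(8*10)))).
by rewrite /= !(subrr, addNr) !addr0.
Qed.

Lemma Der_lie_subalgebra (R : realType) (g : vectType R[i])
    (A : omega_lie g) : lie_subalgebra (@gl_bracket _ g) (Der A) setT.
Proof.
split=> //; split; [split|].
- rewrite inE => x y.
  by rewrite !zero_lfunE linear0l linear0r addr0.
- move=> a d e; rewrite !inE => hd he x y.
  rewrite !add_lfunE !scale_lfunE hd he linearPl linearPr /= scalerDr.
  by rewrite addrACA.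
- move=> d e; rewrite !inE => hd he x y.
  rewrite !gl_bracketE hd he !linearD /= !hd !he.
  rewrite linearBl linearNr !opprD !addrA.
  rewrite [LHS](ACl ((1*5*4*8)*((2*7)*(3*6)))) /=.
  by rewrite !subrr !addr0.
Qed.

(* Main.v *)
Require Import Defs.
From HB Require Import structures.
From mathcomp Require Import all_boot all_order all_algebra.
From mathcomp Require Import sesquilinear.
From mathcomp Require Import boolp classical_sets reals.

Import GRing.Theory.
Local Open Scope ring_scope.

(** An omega-derivation is a derivation that is also skew-adjoint for [omega].
    The derivations form a Lie algebra, and so do the skew-adjoint
    endomorphisms of any bilinear form, being the infinitesimal isometries of
    that form; the omega-derivations are the intersection of the two. *)

(** Moving both factors of a composite across [B] costs two signs and reverses
    their order: [B (d (e x)) y = B x (e (d y))]. The commutator is therefore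
    moved across [B] at the cost of a single sign. *)
Lemma skew_adjoint_gl_bracket (K : fieldType) (V : vectType K)
    (B : {biscalar V}) (d e : 'End(V)) :
  (forall x y, B (d x) y + B x (d y) = 0) ->
  (forall x y, B (e x) y + B x (e y) = 0) ->
  forall x y, B (gl_bracket d e x) y + B x (gl_bracket d e y) = 0.
Proof.
move=> hd he x y; rewrite !gl_bracketE linearBl linearBr /=.
have dl u v : B (d u) v = - B u (d v) by apply/eqP; rewrite -addr_eq0 hd.
have el u v : B (e u) v = - B u (e v) by apply/eqP; rewrite -addr_eq0 he.
by rewrite !dl !el !dl !opprK addrC subrKA subrr.
Qed.

Theorem proposition2p4 (R : realType) (g : vectType R[i]) (A : omega_lie g) :
  nontrivial A ->
  lie_subalgebra (@gl_bracket _ g) (Der_omega A) (Der A).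
Proof.
move=> _; have [_ [[Der0 DerP] DerB]] := Der_lie_subalgebra A.
split=> [d []//|]; split; [split|].
- rewrite inE; split; first by move: Der0; rewrite inE.
  by move=> x y; rewrite !zero_lfunE linear0l linear0r addr0.
- move=> a d e; rewrite !inE => -[dD dO] [eD eO]; split.
    by have := DerP a d e; rewrite !inE; apply.
  move=> x y; rewrite !add_lfunE !scale_lfunE linearPl linearPr /=.
  by rewrite addrACA -mulrDr dO eO mulr0 addr0.
- move=> d e; rewrite !inE => -[dD dO] [eD eO]; split.
    by have := DerB d e; rewrite !inE; apply.
  exact: skew_adjoint_gl_bracket.
Qed.
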